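(* Let $k$ be an infinite field, and let $R$ be a generic standard graded $k$-algebra which (1) has Hilbert series $1+h_1\tau+h_2\tau^2$, (2) is not Gorenstein, and (3) admits a non-free totally reflexive module. Then $R$ has an exact zero divisor. Here genericity means precisely the following: for every integer $e\ge 3$ there is a non-empty open subset $U$ of the Grassmannian $\mathcal G_k(e)$ such that for every $\pi\in U$ the algebra $R_\pi$ satisfies (1), (2) and (3) (with $h_1=e$ and $h_2=e-1$), and $R_\pi$ has an exact zero divisor.
   Context: An algebra satisfying (1)–(3) has $h_1=e$ and $h_2=e-1$ for some $e\ge 3$ (by a result of Yoshino), so the following parameter space is used. For an integer $e\ge 2$ set $m=\frac{e(e+1)}{2}$, $n=\frac{e^2-e+2}{2}$, and let $\mathcal G_k(e)=\operatorname{Grass}_k(n,m)$ be the set of $n$-dimensional $k$-subspaces of the $m$-dimensional space of homogeneous quadratic forms in $k[x_1,\dots,x_e]$. A point $\pi\in\mathcal G_k(e)$, i.e. a subspace $V$, corresponds to the $k$-algebra $R_\pi=k[x_1,\dots,x_e]/(V)$. A subset of $\mathcal G_k(e)$ is open if its image under the Plücker embedding $\mathcal G_k(e)\hookrightarrow\mathbb P_k^N$, $N=\binom mn-1$, is Zariski open in the image of $\mathcal G_k(e)$. A property holds for a generic algebra over an infinite field if there is a non-empty open subset of an appropriate Grassmannian such that every point in that subset corresponds to an algebra having the property. For $x\in R$, $(0:x)$ denotes the annihilator of $x$. A non-invertible element $x\neq 0$ of $R$ is an exact zero divisor if there is $w\in R$ with $(0:x)=(w)$ and $(0:w)=(x)$.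 A finitely generated $R$-module $M$ is totally reflexive if there is an exact sequence $F\colon \cdots\to F_1\to F_0\to F_{-1}\to\cdots$ (infinite in both directions) of finitely generated free $R$-modules such that $M\cong\operatorname{Coker}(F_1\to F_0)$ and $\operatorname{Hom}_R(F,R)$ is also exact. *)

(* Defs.v *)
From HB Require Import structures.
From mathcomp Require Import all_boot all_order all_algebra.
From mathcomp Require Import ring_quotient generic_quotient.
From mathcomp Require boolp.
From mathcomp Require Import mpoly.

Set Implicit Arguments.
Unset Strict Implicit.
Unset Printing Implicit Defensive.

Import GRing.Theory.

Local Open Scope ring_scope.
Local Open Scope quotient_scope.

Definition infinite_field (k : fieldType) : Prop :=
  forall s : seq k, exists x, x \notin s.

Section Modules.
Context (A : comNzRingType).

Definition exact_at (L M N : lmodType A) (f : L -> M) (g : M -> N) : Prop :=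
  forall y, g y = 0 <-> exists x, y = f x.

Definition fin_gen (M : lmodType A) : Prop :=
  exists (n : nat) (b : 'I_n -> M),
    forall x, exists a : 'I_n -> A, x = \sum_i a i *: b i.

Definition generates (M : lmodType A) (B : M -> Prop) : Prop :=
  forall x, exists (n : nat) (b : 'I_n -> M) (a : 'I_n -> A),
    (forall i, B (b i)) /\ x = \sum_i a i *: b i.

Definition lin_indep (M : lmodType A) (B : M -> Prop) : Prop :=
  forall (n : nat) (b : 'I_n -> M) (a : 'I_n -> A),
    injective b -> (forall i, B (b i)) ->
    \sum_i a i *: b i = 0 -> forall i, a i = 0.

Definition is_free (M : lmodType A) : Prop :=
  exists B : M -> Prop, generates B /\ lin_indep B.

Definition is_coker (L N M : lmodType A) (f : L -> N) : Prop :=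
  exists p : {linear N -> M}, (forall y, exists x, p x = y) /\ exact_at f p.

(* The differential out of degree i + 1 is d i, so exactness of F at degree
   i + 1 relates d (i + 1) and d i.  The third condition is exactness of
   Hom(F_i, A) -> Hom(F_{i+1}, A) -> Hom(F_{i+2}, A). *)
Definition totally_reflexive (M : lmodType A) : Prop :=
  fin_gen M /\
  exists (F : int -> lmodType A) (d : forall i, {linear F (i + 1) -> F i}),
    [/\ forall i, fin_gen (F i) /\ is_free (F i),
        forall i, exact_at (d (i + 1)) (d i),
        forall i (f : {linear F (i + 1) -> A^o}),
          (forall x, f (d (i + 1) x) = 0) <->
          exists g : {linear F i -> A^o}, forall x, f x = g (d i x)
      & is_coker M (d 0)].

Definition is_injective (J : lmodType A) : Prop :=
  forall (M N : lmodType A) (i : {linear M -> N}) (f : {linear M -> J}),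
    injective i -> exists g : {linear N -> J}, forall x, g (i x) = f x.

Definition finite_injdim (M : lmodType A) : Prop :=
  exists (J : nat -> lmodType A) (eps : {linear M -> J 0%N})
         (d : forall i, {linear J i -> J i.+1}) (r : nat),
    [/\ forall i, is_injective (J i),
        injective eps,
        exact_at eps (d 0%N),
        forall i, exact_at (d i) (d i.+1)
      & forall i, (r < i)%N -> forall x : J i, x = 0].

(* Gorenstein, for Noetherian rings of finite Krull dimension (such as finitely
   generated algebras over a field): finite self-injective dimension. *)
Definition gorenstein : Prop := finite_injdim A^o.

(* (0 : x) = (w) *)
Definition ann_eq_principal (x w : A) : Prop :=
  forall y, y * x = 0 <-> exists z, y = z * w.

Definition exact_zero_divisor (x : A) : Prop :=
  [/\ x != 0, ~ (exists y, y * x = 1)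
    & exists w, ann_eq_principal x w /\ ann_eq_principal w x].

End Modules.

Definition has_dim (k : fieldType) (L : lmodType k) (W : L -> Prop) (d : nat) :
    Prop :=
  exists b : 'I_d -> L,
    [/\ forall i, W (b i),
        forall a : 'I_d -> k, \sum_i a i *: b i = 0 -> forall i, a i = 0
      & forall x, W x -> exists a : 'I_d -> k, x = \sum_i a i *: b i].

(* Quadratic forms.  The library only makes dhomog finite-dimensional for
   a number of variables of the form n.+1. *)

Definition qform_dim (e : nat) : nat := (e * e.+1)./2.

Definition qform (k : fieldType) (e : nat) := dhomog e k 2.

Lemma dhomog2_vecaxiom (k : fieldType) (e : nat) :
  Vector.axiom (qform_dim e) (dhomog e k 2).
Proof.
rewrite /qform_dim; case: e => [|n].
  rewrite mul0n; exists (fun _ => 0) => [c p q|].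
    by apply/rowP => -[].
  exists (fun _ => 0) => [p|r]; last by apply/rowP => -[].
  apply/val_inj/mpolyP => m /=; rewrite mcoeff0.
  apply/esym/(@dhomog_nemf_coeff _ _ mdeg 2); first exact: dhomog_is_dhomog.
  by have ->: m = 0%MM; [apply/mnmP=> -[] | rewrite /= mdeg0].
have -> : ((n.+1 * n.+2)./2 = 'C(2 + n, 2))%N by rewrite bin2 mulnC.
exact: dhomog_vecaxiom.
Qed.

Section QForm.
Context (k : fieldType) (e : nat).

HB.instance Definition _ := GRing.Lmodule.on (qform k e).

HB.instance Definition _ :=
  Lmodule_hasFinDim.Build k (qform k e) (dhomog2_vecaxiom k e).

End QForm.

Definition grass_dim (e : nat) : nat := (e ^ 2 - e + 2)./2.

Definition grass (k : fieldType) (e : nat) :=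
  {V : {vspace qform k e} | \dim V == grass_dim e}.

Section QuadraticAlgebra.
Context (k : fieldType) (e : nat) (V : {vspace qform k e}).

Definition gen_ideal_prop (p : {mpoly k[e]}) : Prop :=
  exists (n : nat) (a : 'I_n -> {mpoly k[e]}) (v : 'I_n -> qform k e),
    (forall i, v i \in V) /\ p = \sum_i a i * mpoly_of_dhomog (v i).

Definition gen_ideal : {mpoly k[e]} -> bool :=
  fun p => boolp.asbool (gen_ideal_prop p).

Lemma gen_ideal_closed : idealr_closed gen_ideal.
Proof.
split; rewrite /gen_ideal ?unfold_in.
- apply/boolp.asboolP; exists 0%N, (fun=> 0), (fun=> 0).
  by rewrite big_ord0; split=> // -[].
- apply/boolp.asboolP => -[n [a [v [_ /(congr1 (mcoeff 0%MM))]]]].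
  rewrite mcoeff1 eqxx raddf_sum /= big1 => [|i _]; last first.
    rewrite rmorphM /= (@dhomog_nemf_coeff _ _ mdeg 2 (v i)) ?mulr0 //.
      exact: dhomog_is_dhomog.
    by rewrite /= mdeg0.
  by move/eqP; rewrite oner_eq0.
- move=> c p q; rewrite !unfold_in.
  move=> /boolp.asboolP[n [a [v [Vv ->]]]] /boolp.asboolP[m [b [w [Vw ->]]]].
  apply/boolp.asboolP; exists (n + m)%N.
  exists (fun i => match split i with inl j => c * a j | inr j => b j end).
  exists (fun i => match split i with inl j => v j | inr j => w j end).
  split=> [i|]; first by case: (split i).
  rewrite big_split_ord /= mulr_sumr; congr (_ + _); apply: eq_bigr => i _.
    by rewrite (unsplitK (inl i)) mulrA.
  by rewrite (unsplitK (inr i)).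
Qed.

HB.instance Definition _ := isIdealr.Build {mpoly k[e]} gen_ideal gen_ideal_closed.

Definition quad_ideal : idealr {mpoly k[e]} := gen_ideal.

Definition quad_alg := {ideal_quot quad_ideal}.

HB.instance Definition _ := GRing.ComNzRing.on quad_alg.

Definition quad_proj (p : {mpoly k[e]}) : quad_alg := \pi_quad_alg p.

Definition quad_scale (c : k) (u : quad_alg) : quad_alg := quad_proj c%:MP * u.

Lemma quad_projM : {morph quad_proj : p q / p * q}.
Proof. by move=> p q; rewrite /quad_proj -rmorphM. Qed.

Lemma quad_projD : {morph quad_proj : p q / p + q}.
Proof. by move=> p q; rewrite /quad_proj -rmorphD. Qed.

Lemma quad_scaleA a b u : quad_scale a (quad_scale b u) = quad_scale (a * b) u.
Proof. by rewrite /quad_scale mulrA -quad_projM mpolyCM. Qed.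

Lemma quad_scale1 : left_id 1 quad_scale.
Proof. by move=> u; rewrite /quad_scale /quad_proj mpolyC1 rmorph1 mul1r. Qed.

Lemma quad_scaleDr : right_distributive quad_scale +%R.
Proof. by move=> c u v; rewrite /quad_scale mulrDr. Qed.

Lemma quad_scaleDl u : {morph quad_scale^~ u : a b / a + b}.
Proof. by move=> a b; rewrite /quad_scale mpolyCD quad_projD mulrDl. Qed.

HB.instance Definition _ := GRing.Zmodule_isLmodule.Build k quad_alg
  quad_scaleA quad_scale1 quad_scaleDr quad_scaleDl.

Lemma quad_scaleAl (c : k) (u v : quad_alg) : c *: (u * v) = (c *: u) * v.
Proof. exact: mulrA. Qed.

HB.instance Definition _ :=
  GRing.Lmodule_isLalgebra.Build k quad_alg quad_scaleAl.

HB.instance Definition _ := GRing.Lalgebra_isComAlgebra.Build k quad_alg.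

Definition graded_piece (i : nat) (u : quad_alg) : Prop :=
  exists2 p : {mpoly k[e]}, p \is i.-homog & u = quad_proj p.

Definition has_hilbert_series (h : {poly nat}) : Prop :=
  forall i : nat, has_dim (graded_piece i) (h`_i)%R.

End QuadraticAlgebra.

Definition quad_mnm (e : nat) : seq 'X_{1..e} :=
  [seq s2m t | t : 2.-tuple 'I_e <- enum (basis e 2)].

Lemma size_quad_mnm (e : nat) : size (quad_mnm e) = qform_dim e.
Proof.
rewrite /qform_dim; case: e => [|n]; last by rewrite size_basis bin2 mulnC.
by rewrite size_map -cardE; apply: eq_card0 => -[[|[]]].
Qed.

Section Plucker.
Context (k : fieldType) (e : nat).

Let m := qform_dim e.
Let n := grass_dim e.

Definition coef_mx (b : n.-tuple (qform k e)) : 'M[k]_(n, m) :=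
  \matrix_(i, j) (mpoly_of_dhomog (tnth b i))@_(nth 0%MM (quad_mnm e) j).

(* The r-th strictly increasing n-tuple of columns. *)
Definition plucker_cols (r : 'I_'C(m, n)) : n.-tuple 'I_m :=
  enum_val (cast_ord (esym (card_ltn_sorted_tuples n m)) r).

Definition plucker_coord (b : n.-tuple (qform k e)) (r : 'I_'C(m, n)) : k :=
  \det (colsub (tnth (plucker_cols r)) (coef_mx b)).

(* Points of P^N, N + 1 = 'C(m, n), are nonzero vectors up to proportionality;
   a subset of P^N is a scaling-invariant predicate on nonzero vectors.
   [plucker_image U] is such a predicate: changing the basis of V multiplies
   its coordinates by an arbitrary nonzero scalar. *)
Definition plucker_image (U : grass k e -> Prop) (v : 'I_'C(m, n) -> k) : Prop :=
  exists (pi : grass k e) (b : n.-tuple (qform k e)),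
    [/\ U pi, basis_of (val pi) b & v =1 plucker_coord b].

Definition zariski_open (O : ('I_'C(m, n) -> k) -> Prop) : Prop :=
  exists S : {mpoly k['C(m, n)]} -> Prop,
    (forall f, S f -> exists d, f \is d.-homog) /\
    (forall v, (exists r, v r != 0) -> (O v <-> exists2 f, S f & f.@[v] != 0)).

Definition grass_open (U : grass k e -> Prop) : Prop :=
  exists2 O, zariski_open O
    & forall v, (exists r, v r != 0) ->
        (plucker_image U v <-> plucker_image (fun=> True) v /\ O v).

End Plucker.

(* Main.v *)
Require Import Defs.
From HB Require Import structures.
From mathcomp Require Import all_boot all_order all_algebra all_fingroup.
From mathcomp Require Import ring_quotient generic_quotient.
From mathcomp Require boolp.
From mathcomp Require Import mpoly ring zify.

Set Implicit Arguments.
Unset Strict Implicit.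
Unset Printing Implicit Defensive.

Import GRing.Theory.

Local Open Scope ring_scope.
Local Open Scope quotient_scope.

(** Write x = X_0 for the first variable and let V be a subspace of quadratic
    forms of codimension e - 1.  For generic V, multiplication by x maps the
    linear forms onto the degree 2 part of R = k[X_0, ..., X_(e-1)]/(V), with a
    one-dimensional kernel spanned by some linear form w; generically w also
    maps the linear forms onto R_2.  These two conditions force everything:
    R_3 = R_2 R_1 = w R_1 R_1 = w R_2 = w x R_1 = 0 because x w = 0, so R has
    Hilbert series 1 + e t + (e-1) t^2, and a dimension count gives
    (0 : x) = (w) and (0 : w) = (x).

    To see that they define a nonempty open set, restrict to the chart of the
    Grassmannian on which V is complementary to the span of the products
    x X_l, l > 0.  There V has a reduced basis, whose coefficients, multiplied
    by the determinant delta of the pivot columns, are maximal minors of any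
    coefficient matrix of V, that is, up to sign, Plucker coordinates or 0
    ([adj_mul_minor], [det_colsub_plucker]).  The coefficients of w can be read
    off the reduced basis, and so can the matrix of multiplication by w from
    the X_l, l > 0, to the basis x X_l of R_2.  The product of delta and the
    determinant of that matrix is a form in the Plucker coordinates
    ([chart_value_plucker]); it is nonzero at the span of the pivot monomials
    ([chart_locus_nonempty]).

    An exact pair of zero divisors x, w yields the totally reflexive module
    (w), isomorphic to R/(x), with the 2-periodic complete resolution given by
    multiplication by x and by w alternately; it is not free because x kills it
    ([totally_reflexive_principal], [principal_not_free]).

    R is not Gorenstein because its socle contains R_2, of dimension at least 2
    ([not_gorenstein_two_socle]).  Fix a nonzero socle element sigma.  In a
    finite injective resolution of R, each socle element of each cosyzygy is
    sigma times an element of the same cosyzygy; this is shown by downward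
    induction on the degree.  For the zeroth cosyzygy, R itself, it says that
    the socle is contained in (sigma). *)

(** * Ideals as modules *)

Section IdealModule.
Context (A : comNzRingType).

(** Ideals of [A] as predicates with values in [Prop]; the unit ideal is
    allowed. *)
Record ideal := Ideal {
  in_ideal : A -> Prop;
  ideal0 : in_ideal 0;
  idealD : forall c x y, in_ideal x -> in_ideal y -> in_ideal (c * x + y) }.

Context (I : ideal).

Definition ideal_pred : {pred A^o} := fun x => boolp.asbool (in_ideal I x).

Fact ideal_pred_closed : submod_closed ideal_pred.
Proof.
split; first exact/boolp.asboolP/ideal0.
by move=> c x y /boolp.asboolP Ix /boolp.asboolP Iy; apply/boolp.asboolP/idealD.
Qed.

HB.instance Definition _ :=
  GRing.isSubmodClosed.Build A A^o ideal_pred ideal_pred_closed.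

(** The ideal [I] as a submodule of the regular module. *)
Record ideal_mod := IdealMod { ideal_val :> A^o; _ : ideal_val \in ideal_pred }.

HB.instance Definition _ := [isSub for ideal_val].
HB.instance Definition _ := [Choice of ideal_mod by <:].
HB.instance Definition _ := [SubChoice_isSubLmodule of ideal_mod by <:].

Lemma ideal_valP (x : ideal_mod) : in_ideal I (ideal_val x).
Proof. by apply/boolp.asboolP; case: x. Qed.

Definition to_ideal (x : A) (Ix : in_ideal I x) : ideal_mod :=
  @IdealMod x (introT (boolp.asboolP _) Ix).

End IdealModule.

(** * Totally reflexive modules from exact zero divisors *)

Section ExactPair.
Context (A : comNzRingType).

(** Multiplication by [x], an endomorphism of the regular module. *)
Definition mulby (x : A) (y : A^o) : A^o := y * x.

Fact mulby_linear x : linear (mulby x).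
Proof. by move=> c y z; rewrite /mulby mulrDl -scalerAl. Qed.

HB.instance Definition _ x :=
  GRing.isLinear.Build A A^o A^o _ (mulby x) (mulby_linear x).

Lemma linear_regular (f : {linear A^o -> A^o}) (y : A^o) : f y = y * f 1.
Proof. by rewrite -[in LHS](mulr1 y) -[y * 1]/(y *: (1 : A^o)) linearZ. Qed.

Fact multiples0 (w : A) : exists z, 0 = z * w.
Proof. by exists 0; rewrite mul0r. Qed.

Fact multiplesD (w c x y : A) :
  (exists z, x = z * w) -> (exists z, y = z * w) ->
  exists z, c * x + y = z * w.
Proof. by move=> [a ->] [b ->]; exists (c * a + b); rewrite mulrDl mulrA. Qed.

(** The ideal generated by [w]. *)
Definition principal (w : A) : ideal A :=
  Ideal (multiples0 w) (@multiplesD w).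

Lemma in_principal (w y : A) : in_ideal (principal w) (y * w).
Proof. by exists y. Qed.

(** The surjection from the regular module onto the ideal [(w)]. *)
Definition onto_principal (w : A) (y : A^o) : ideal_mod (principal w) :=
  to_ideal (in_principal w y).

Fact onto_principal_linear w : linear (onto_principal w).
Proof. by move=> c y z; apply/val_inj/mulby_linear. Qed.

HB.instance Definition _ w :=
  GRing.isLinear.Build A A^o (ideal_mod (principal w)) _
    (onto_principal w) (onto_principal_linear w).

Lemma onto_principal_surj w u : exists y, onto_principal w y = u.
Proof.
by case: (ideal_valP u) => y uE; exists y; apply/val_inj; rewrite /= -uE.
Qed.

Lemma free_regular : fin_gen A^o /\ is_free A^o.
Proof.
split.
  exists 1%N, (fun=> 1) => x; exists (fun=> x).
  by rewrite big_ord1 /GRing.scale /= mulr1.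
exists (fun x => x = 1); split.
  move=> x; exists 1%N, (fun=> 1), (fun=> x); split=> //.
  by rewrite big_ord1 /GRing.scale /= mulr1.
move=> n b a b_inj b1 s0 i.
have all_i j : j = i by apply: b_inj; rewrite !b1.
move: s0; rewrite (bigD1 i) //= big1 => [|j /eqP[]] //.
by rewrite addr0 b1 /GRing.scale /= mulr1.
Qed.

Context (x w : A).
Hypotheses (x_neq0 : x != 0) (w_neq0 : w != 0).
Hypotheses (ann_x : ann_eq_principal x w) (ann_w : ann_eq_principal w x).

Lemma totally_reflexive_principal :
  totally_reflexive (ideal_mod (principal w)).
Proof.
split.
  exists 1%N, (fun=> onto_principal w 1) => u.
  have [y <-] := onto_principal_surj u; exists (fun=> y).
  by rewrite big_ord1 -linearZ_LR /GRing.scale /= mulr1.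
(* The differentials are multiplications by x in even degrees, by w in odd
   degrees. *)
pose c (i : int) := if odd `|i|%N then w else x.
have c1 i : c (i + 1) = if odd `|i|%N then x else w.
  rewrite /c; case: i => [n|[|n]] //; first by rewrite -PoszD addn1 /= if_neg.
  by rewrite NegzE addrC subzSS sub0r !abszN /= if_neg negbK.
have ann_c i : ann_eq_principal (c i) (c (i + 1)).
  by rewrite c1 /c; case: ifP.
have ann_c1 i : ann_eq_principal (c (i + 1)) (c i).
  by rewrite c1 /c; case: ifP.
exists (fun=> A^o), (fun i => mulby (c i)); split=> //.
- by move=> _; exact: free_regular.
- move=> i f; split=> [f0|[g gE] y].
    have /ann_c1[z f1] : f 1 * c (i + 1) = 0.
      by have := f0 1; rewrite linear_regular /= /mulby mul1r mulrC.
    exists (mulby z) => y.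
    by rewrite linear_regular f1 /= /mulby mulrA mulrAC.
  rewrite gE /= linear_regular /mulby -(mulrA y) (ann_c i _).2 ?mulr0 ?mul0r //.
  by exists 1; rewrite mul1r.
- exists (onto_principal w); split; first exact: onto_principal_surj.
  move=> y; split=> [/(congr1 (@ideal_val _ _))/ann_w //|/ann_w y0].
  exact/val_inj.
Qed.

Lemma principal_not_free : ~ is_free (ideal_mod (principal w)).
Proof.
case=> B [genB indB].
have [n [b [a [Bb wE]]]] := genB (onto_principal w 1).
case: n => [|n] in b a Bb wE.
  move/(congr1 (@ideal_val _ _)): wE.
  by rewrite big_ord0 /= mul1r => /eqP; rewrite (negPf w_neq0).
have [y yE] := onto_principal_surj (b ord0).
(* A basis element is a multiple of w, so that x kills it. *)
have xb : x *: b ord0 = 0.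
  apply/val_inj; rewrite -yE /= -[_ *: _]/(x * (y * w)) mulrCA (mulrC x).
  by rewrite (ann_x w).2 ?mulr0 //; exists 1; rewrite mul1r.
apply/(negP x_neq0)/eqP.
apply: (@indB 1%N (fun=> b ord0) (fun=> x) _ _ _ ord0) => //.
  by move=> i j _; rewrite !ord1.
by rewrite big_ord1.
Qed.

End ExactPair.

(** * Two independent socle elements exclude finite self-injective dimension *)

Section NotGorenstein.
Context (A : comNzRingType).

(** The extension property of an injective module [J] for the ideal generated
    by [I] and [v]: the map that vanishes on [I] and sends [v] to [u] is
    multiplication by some element of [J], as soon as it is well defined. *)
Lemma injective_module_extend (J : lmodType A) (I : ideal A) (v : A) (u : J) :
    is_injective J -> (forall c, in_ideal I (c * v) -> c *: u = 0) ->
  exists y : J, (forall a, in_ideal I a -> a *: y = 0) /\ v *: y = u.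
Proof.
move=> injJ Iv.
pose K a := exists c, in_ideal I (a - c * v).
have K0 : K 0 by exists 0; rewrite mul0r subr0; apply: ideal0.
have KD c a b : K a -> K b -> K (c * a + b).
  move=> [c1 I1] [c2 I2]; exists (c * c1 + c2).
  by rewrite mulrDl opprD addrACA -mulrA -mulrBr; apply: idealD.
pose KI := Ideal K0 KD.
have coefP (a : ideal_mod KI) : exists c, in_ideal I (ideal_val a - c * v).
  exact: (ideal_valP a).
pose coef a := sval (boolp.cid (coefP a)).
have coef_spec a : in_ideal I (ideal_val a - coef a * v).
  exact: (svalP (boolp.cid (coefP a))).
have subI a b : in_ideal I a -> in_ideal I b -> in_ideal I (a - b).
  by move=> Ia Ib; rewrite addrC -mulN1r; apply: idealD.
(* The image of a does not depend on the chosen expression of a. *)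
have coefE (a : ideal_mod KI) c :
    in_ideal I (ideal_val a - c * v) -> coef a *: u = c *: u.
  move=> Iac; apply/eqP; rewrite -subr_eq0 -scalerBl; apply/eqP/Iv.
  have := subI _ _ Iac (coef_spec a).
  by rewrite opprB addrC addrA subrK mulrBl.
have lin_ext : linear (fun a => coef a *: u).
  move=> c a b; rewrite scalerA -scalerDl; apply: coefE.
  rewrite /= -[_ *: _]/(c * _) mulrDl opprD addrACA -mulrA -mulrBr.
  exact: idealD.
pose ext (a : ideal_mod KI) := coef a *: u.
have [f fE] : exists f : {linear ideal_mod KI -> J}, f =1 ext.
  pose m := GRing.isLinear.Build A (ideal_mod KI) J _ ext lin_ext.
  pose f : {linear ideal_mod KI -> J} := HB.pack ext m.
  by exists f.
have lin_val : linear (@ideal_val A KI) by [].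
pose mv :=
  GRing.isLinear.Build A (ideal_mod KI) A^o _ (@ideal_val A KI) lin_val.
pose iota : {linear ideal_mod KI -> A^o} := HB.pack (@ideal_val A KI) mv.
have [g gE] := injJ _ _ iota f val_inj.
have gK a (Ka : K a) c : in_ideal I (a - c * v) -> a *: g 1 = c *: u.
  move=> Ia; rewrite -linearZ_LR -[a *: 1]/(a * 1) mulr1.
  by have := gE (@to_ideal _ KI a Ka); rewrite fE => ->; apply: coefE.
exists (g 1); split=> [a Ia|].
  have Ia0 : in_ideal I (a - 0 * v) by rewrite mul0r subr0.
  by rewrite (gK a _ 0) ?scale0r //; exists 0.
have Iv1 : in_ideal I (v - 1 * v) by rewrite mul1r subrr; apply: ideal0.
by rewrite (gK v _ 1) ?scale1r //; exists 1.
Qed.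

(** Membership in the ideal generated by the elements of [s]. *)
Fixpoint seq_ideal (s : seq A) (x : A) : Prop :=
  if s is v :: s' then exists c, seq_ideal s' (x - c * v) else x = 0.

Fact seq_ideal0 s : seq_ideal s 0.
Proof. by elim: s => //= v s IHs; exists 0; rewrite mul0r subr0. Qed.

Fact seq_idealD s c x y :
  seq_ideal s x -> seq_ideal s y -> seq_ideal s (c * x + y).
Proof.
elim: s c x y => [|v s IHs] c x y /=.
  by move=> -> ->; rewrite mulr0 addr0.
move=> [a sx] [b sy]; exists (c * a + b).
by rewrite mulrDl opprD addrACA -mulrA -mulrBr; apply: IHs.
Qed.

Definition span_ideal s : ideal A := Ideal (seq_ideal0 s) (@seq_idealD s).

Lemma seq_idealM s c x : seq_ideal s x -> seq_ideal s (c * x).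
Proof.
by move=> sx; rewrite -[_ * _]addr0; apply: seq_idealD => //; apply: seq_ideal0.
Qed.

Lemma seq_idealD1 s x y : seq_ideal s x -> seq_ideal s y -> seq_ideal s (x + y).
Proof. by move=> sx sy; rewrite -[x]mul1r; apply: seq_idealD. Qed.

Lemma seq_ideal_cons v s x : seq_ideal s x -> seq_ideal (v :: s) x.
Proof. by exists 0; rewrite mul0r subr0. Qed.

Lemma mem_seq_ideal v s : v \in s -> seq_ideal s v.
Proof.
elim: s => //= u s IHs; rewrite inE => /predU1P[->|/IHs].
  by exists 1; rewrite mul1r subrr; apply: seq_ideal0.
exact: seq_ideal_cons.
Qed.

Lemma seq_ideal_sum s (J : finType) (b v : J -> A) :
  (forall j, v j \in s) -> seq_ideal s (\sum_j b j * v j).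
Proof.
move=> sv; elim/big_ind: _ => [|x y|j _]; first exact: seq_ideal0.
  exact: seq_idealD1.
exact/seq_idealM/mem_seq_ideal.
Qed.

Lemma seq_ideal_catr s1 s2 x : seq_ideal s2 x -> seq_ideal (s1 ++ s2) x.
Proof. by elim: s1 => //= v s IHs sx; apply/seq_ideal_cons/IHs. Qed.

(* mm is the set of non-invertible elements of a local ring. *)
Context (mm : A -> Prop).

(** Each element of [s] is killed by [mm] modulo the ideal generated by the
    elements that follow it; the suffixes of [s] thus generate a flag of ideals
    with simple or zero successive quotients. *)
Fixpoint socle_flag (s : seq A) : Prop :=
  if s is v :: s' then
    (forall a, mm a -> seq_ideal s' (a * v)) /\ socle_flag s'
  else True.

Lemma socle_flag_cat s1 s2 :
    (forall v a, v \in s1 -> mm a -> seq_ideal s2 (a * v)) ->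
  socle_flag s2 -> socle_flag (s1 ++ s2).
Proof.
elim: s1 => //= v s IHs sv s2_flag; split.
  by move=> a mma; apply/seq_ideal_catr/sv; rewrite ?mem_head.
by apply: IHs => // u a us; apply: sv; rewrite inE us orbT.
Qed.

Context (sigma : A).
Hypothesis mm_local : forall c, mm c \/ exists d, d * c = 1.
Hypothesis sigma_neq0 : sigma != 0.
Hypothesis mm_sigma : forall a, mm a -> a * sigma = 0.

(** An injective module contains a quotient by [sigma] of each of its socle
    elements: [sigma] generates a copy of the residue field in [A]. *)
Lemma divide_by_socle (J : lmodType A) (u : J) :
    is_injective J -> (forall a, mm a -> a *: u = 0) ->
  exists y, sigma *: y = u.
Proof.
move=> injJ mmu.
have [|y [_ <-]] := @injective_module_extend J (span_ideal [::]) sigma u injJ.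
  move=> c /= c0; have [/mmu //|[d dc]] := mm_local c.
  by case/eqP: sigma_neq0; rewrite -[sigma]mul1r -dc -mulrA c0 mulr0.
by exists y.
Qed.

Section Lift.
Context (J J' J'' : lmodType A) (f : {linear J -> J'}) (g : {linear J' -> J''}).
Hypotheses (injJ : is_injective J) (exact_fg : exact_at f g).
Hypothesis ker_g_divide : forall s : J', g s = 0 ->
  (forall a, mm a -> a *: s = 0) -> exists2 t, g t = 0 & sigma *: t = s.

(** Homomorphisms from [A/(s)] to the kernel of [g] lift along [f].  A
    homomorphism from [A/(s)] is given as an element killed by the ideal. *)
Definition lifts_annihilator (s : seq A) : Prop :=
  forall t, g t = 0 -> (forall a, seq_ideal s a -> a *: t = 0) ->
  exists2 y, f y = t & forall a, seq_ideal s a -> a *: y = 0.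

(** Passing from a member of the flag to the next smaller one.  For a
    homomorphism [t] from [A/(s)], the element [v *: t] lies in the socle, hence
    is [sigma *: t'], and [sigma] times a lift of [t'] lifts it to a socle
    element of [J].  The resulting map on the submodule generated by [v] extends
    to [A/(s)], as [J] is injective; subtracting its image leaves a homomorphism
    that factors through [A/(v :: s)]. *)
Lemma lifts_annihilator_behead v s :
    (forall a, mm a -> seq_ideal s (a * v)) ->
  lifts_annihilator (v :: s) -> lifts_annihilator s.
Proof.
move=> mm_v lift_vs t gt0 st0.
have [sv|nsv] := boolp.pselect (seq_ideal s v).
  have vs_s a : seq_ideal (v :: s) a -> seq_ideal s a.
    by case=> c /= sa; rewrite -(subrK (c * v) a); apply/seq_idealD1/seq_idealM.
  have [|y fy vsy] := lift_vs t gt0; first by move=> a /vs_s/st0.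
  by exists y => // a sa; apply/vsy/seq_ideal_cons.
have [||t' gt' t'E] := @ker_g_divide (v *: t).
  by rewrite linearZ_LR gt0 scaler0.
  by move=> a mma; rewrite scalerA; apply/st0/mm_v.
have [u' fu'] := (exact_fg t').1 gt'.
have [|y [sy vy]] :=
    @injective_module_extend J (span_ideal s) v (sigma *: u') injJ.
  move=> c scv; have [mmc|[d dc]] := mm_local c.
    by rewrite scalerA mm_sigma ?scale0r.
  by case: nsv; rewrite -[v]mul1r -dc -mulrA; apply: seq_idealM.
have vfy : v *: f y = v *: t by rewrite -linearZ_LR vy linearZ_LR -fu' t'E.
have [||z fz sz] := lift_vs (t - f y).
- by rewrite linearB gt0 sub0r (exact_fg _).2 ?oppr0 //; exists y.
- move=> a [c sac]; rewrite -(subrK (c * v) a) scalerDl -scalerA !scalerBr vfy.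
  by rewrite (st0 _ sac) -(linearZ_LR f) sy // linear0 !subrr addr0.
exists (z + y); first by rewrite linearD fz subrK.
by move=> a sa; rewrite scalerDr sy // sz ?addr0 //; apply: seq_ideal_cons.
Qed.

Lemma lifts_annihilator_suffix s1 s2 :
  socle_flag (s1 ++ s2) -> lifts_annihilator (s1 ++ s2) -> lifts_annihilator s2.
Proof.
elim: s1 => //= v s1 IHs [mm_v flag_s] /lifts_annihilator_behead lift_s.
exact/IHs/lift_s.
Qed.

Lemma lifts_annihilator_unit s : seq_ideal s 1 -> lifts_annihilator s.
Proof.
move=> s1 t _ /(_ 1 s1); rewrite scale1r => ->.
by exists 0; rewrite ?linear0 // => a _; rewrite scaler0.
Qed.

End Lift.

Context (tau : A) (s : seq A).
Hypothesis s_flag : socle_flag (s ++ [:: sigma]).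
Hypothesis s_full : seq_ideal (s ++ [:: sigma]) 1.
Hypothesis mm_tau : forall a, mm a -> a * tau = 0.
Hypothesis tau_indep : forall y, tau <> y * sigma.

(** The induction runs over the kernels of the [d i], from the top degree down
    to the image of [A]: a socle element [u] of such a kernel is [sigma *: y0]
    in the injective module, and [y0] is corrected by a lift, killed by
    [sigma], of its image in the next module. *)
Lemma not_gorenstein_two_socle : ~ gorenstein A.
Proof.
case=> J [eps [d [r [injJ inj_eps exact_eps exact_d J0]]]].
have W j : (j <= r.+1)%N -> forall u : J (r.+1 - j)%N, d _ u = 0 ->
    (forall a, mm a -> a *: u = 0) ->
    exists2 t, d _ t = 0 & sigma *: t = u.
  elim: j => [_ u _ _|j IHj j_le].
    by exists 0; rewrite ?linear0 // [RHS]J0 // subn0.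
  move: (IHj (ltnW j_le)) => {IHj}; rewrite subSn // subSS => Wi.
  move: (r - j)%N Wi => i Wi u du0 mmu.
  have [y0 y0E] := divide_by_socle (injJ i) mmu.
  have /lifts_annihilator_unit L := s_full.
  have := lifts_annihilator_suffix (injJ i) (exact_d i) Wi s_flag (L _ _ _ _ _).
  case/(_ (d i y0)) => [||z dz sz].
  - by apply/(exact_d i); exists y0.
  - move=> a [c /eqP]; rewrite subr_eq0 => /eqP->.
    by rewrite -scalerA -(linearZ_LR (d i)) y0E du0 scaler0.
  exists (y0 - z); first by rewrite linearB dz subrr.
  by rewrite scalerBr y0E sz ?subr0 //; apply: mem_seq_ideal; rewrite mem_head.
have := W r.+1 (leqnn _); rewrite subnn => /(_ (eps tau)).
have eps_tau a : mm a -> a *: eps tau = 0.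
  move=> mma; rewrite -linearZ_LR -[a *: (tau : A^o)]/(a * tau).
  by rewrite mm_tau // linear0.
case=> // [|t dt0 tE]; first by apply/(exact_eps _); exists tau.
have [y yE] := (exact_eps t).1 dt0; apply: (tau_indep (y := y)).
by apply: inj_eps; rewrite -tE yE -linearZ_LR mulrC.
Qed.

End NotGorenstein.

(** * Monomials and Plucker coordinates *)

Section QuadMonomials.
Context (e : nat).
Implicit Types (c : 'I_(qform_dim e)) (i j : 'I_e).

(** The monomial that labels the column [c] of a coefficient matrix. *)
Definition qmon c : 'X_{1..e} := nth 0%MM (quad_mnm e) c.

Lemma mem_quad_mnm (m : 'X_{1..e}) : (m \in quad_mnm e) = (mdeg m == 2).
Proof. by rewrite [RHS]basis_cover. Qed.

Lemma mdeg_qmon c : mdeg (qmon c) = 2.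
Proof. by apply/eqP; rewrite -mem_quad_mnm mem_nth ?size_quad_mnm. Qed.

Lemma qmon_inj : injective qmon.
Proof.
move=> c d /eqP; rewrite nth_uniq ?size_quad_mnm //; last exact: uniq_basis.
by move/eqP/val_inj.
Qed.

Fact qindex_subproof i j :
  (index (U_(i) + U_(j))%MM (quad_mnm e) < qform_dim e)%N.
Proof. by rewrite -size_quad_mnm index_mem mem_quad_mnm mdegD !mdeg1. Qed.

(** The column of the monomial [X_i X_j]. *)
Definition qcol i j := Ordinal (qindex_subproof i j).

Lemma qmon_qcol i j : qmon (qcol i j) = (U_(i) + U_(j))%MM.
Proof. by rewrite /qmon nth_index // mem_quad_mnm mdegD !mdeg1. Qed.

Lemma mnm_factor d (m : 'X_{1..e}) :
  mdeg m = d.+1 -> exists i m', m = (U_(i) + m')%MM /\ mdeg m' = d.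
Proof.
move=> dm; have [i mi] : exists i, m i != 0%N.
  apply/existsP; apply: contraT => /existsPn m0.
  suffices m00 : m = 0%MM by rewrite m00 mdeg0 in dm.
  by apply/mnmP=> i; rewrite mnm0E; apply/eqP; rewrite -[_ == _]negbK m0.
have le_im : (U_(i) <= m)%MM by rewrite lep1mP.
exists i, (m - U_(i))%MM; rewrite addmC submK //; split=> //.
by move: dm; rewrite -[in mdeg m](submK le_im) mdegD mdeg1 addn1 => -[].
Qed.

Lemma homog2E (k : fieldType) (p : {mpoly k[e]}) :
  p \is 2.-homog -> p = \sum_c p@_(qmon c) *: 'X_[qmon c].
Proof.
move=> homp; apply/mpolyP=> m; rewrite raddf_sum /=.
have [dm|ndm] := eqVneq (mdeg m) 2; last first.
  rewrite (dhomog_nemf_coeff homp ndm) big1 // => c _.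
  rewrite mcoeffZ mcoeffX; case: eqP => [cm|]; rewrite ?mulr0 //.
  by rewrite -cm mdeg_qmon eqxx in ndm.
have [c <-] : exists c, qmon c = m.
  have mq : m \in quad_mnm e by rewrite mem_quad_mnm dm.
  have lt_m : (index m (quad_mnm e) < qform_dim e)%N.
    by rewrite -size_quad_mnm index_mem.
  by exists (Ordinal lt_m); rewrite /qmon nth_index.
rewrite (bigD1 c) //= mcoeffZ mcoeffX eqxx mulr1 big1 ?addr0 // => d ndc.
by rewrite mcoeffZ mcoeffX (inj_eq qmon_inj) (negPf ndc) mulr0.
Qed.

End QuadMonomials.

Section PluckerForms.
Context (k : fieldType) (e : nat).
Local Notation m := (qform_dim e).
Local Notation n := (grass_dim e).

Lemma plucker_cols_surj (t : n.-tuple 'I_m) :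
  sorted ltn (map val t) -> exists r, plucker_cols r = t.
Proof.
move=> sort_t.
have t_in : t \in [set t : n.-tuple 'I_m | sorted ltn (map val t)].
  by rewrite inE.
exists (cast_ord (card_ltn_sorted_tuples n m) (enum_rank_in t_in t)).
by rewrite /plucker_cols cast_ordK enum_rankK_in.
Qed.

(** Any maximal minor, for columns in any order and with possible repetitions,
    is a linear form in the Plucker coordinates: one of them up to sign, or 0
    if a column is repeated. *)
Lemma det_colsub_plucker (g : 'I_n -> 'I_m) :
  exists2 l : {mpoly k['C(m, n)]}, l \is 1.-homog
    & forall b, \det (colsub g (coef_mx b)) = l.@[@plucker_coord k e b].
Proof.
have [g_inj|] := altP (injectiveP g); last first.
  case/injectivePn=> i [j neq_ij gij]; exists 0; first exact: dhomog0.
  move=> b; rewrite meval0 -det_tr; apply: (determinant_alternate neq_ij) => l.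
  by rewrite !mxE gij.
pose leI := relpre (val : 'I_m -> nat) leq.
have sz : size (sort leI (codom g)) == n.
  by rewrite size_sort size_codom card_ord.
pose t := Tuple sz.
have sort_t : sorted ltn (map val t).
  rewrite ltn_sorted_uniq_leq map_inj_uniq ?sort_uniq; last exact: val_inj.
  rewrite (_ : uniq _) /=; last by apply/injectiveP.
  by rewrite sorted_map sort_sorted // => i j; apply: leq_total.
have [r rE] := plucker_cols_surj sort_t.
have /tuple_permP[s sE] : perm_eq (codom g) t by rewrite perm_sym perm_sort.
have gE i : g i = tnth t (s i).
  have := congr1 (fun u => nth (g i) u i) sE.
  rewrite codomE (nth_map i) ?size_enum_ord // nth_ord_enum => ->.
  by rewrite -tnth_nth tnth_mktuple.
exists ((-1) ^+ s *: 'X_r); first by rewrite dhomogZ // dhomogX /= mdeg1.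
move=> b; rewrite mevalZ mevalXU /plucker_coord rE.
have -> : colsub g (coef_mx b) = col_perm s (colsub (tnth t) (coef_mx b)).
  by apply/matrixP=> i j; rewrite !mxE gE.
by rewrite col_permE det_mulmx det_perm odd_permV mulrC.
Qed.

End PluckerForms.

(** * Low degrees of the ideal of quadrics *)

Section QuadAlg.
Context (k : fieldType) (e : nat) (V : {vspace qform k e}).
Local Notation R := (quad_alg V).
Local Notation proj := (@quad_proj k e V).

Lemma quad_proj_eq0 p : proj p = 0 <-> gen_ideal_prop V p.
Proof.
have idealE : (p \in quad_ideal V) = (proj p == 0).
  rewrite -[p in LHS]subr0 (Quotient.idealrBE (quad_ideal V)).
  by rewrite [X in _ = (_ == X)](_ : 0 = proj 0) //; apply/esym/rmorph0.
split=> [/eqP|Vp]; first by rewrite -idealE => /boolp.asboolP.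
by apply/eqP; rewrite -idealE; apply/boolp.asboolP.
Qed.

Lemma quad_proj0 : proj 0 = 0.
Proof. exact: (rmorph0 (\pi_R)). Qed.

Lemma quad_proj1 : proj 1 = 1.
Proof. exact: (rmorph1 (\pi_R)). Qed.

Lemma quad_projZ c p : proj (c *: p) = c *: proj p.
Proof. by rewrite -mul_mpolyC quad_projM. Qed.

Lemma quad_proj_sum (J : finType) (P : pred J) (F : J -> {mpoly k[e]}) :
  proj (\sum_(j | P j) F j) = \sum_(j | P j) proj (F j).
Proof.
apply: (big_morph proj) => [p q|]; [exact: quad_projD | exact: quad_proj0].
Qed.

Lemma quad_projP (u : R) : exists p, u = proj p.
Proof. by exists (repr u); rewrite /quad_proj reprK. Qed.

(** In degree at most 2, a multiple of a quadratic form only sees the constant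
    term of the multiplier. *)
Lemma mcoeff_lowM (a : {mpoly k[e]}) (v : qform k e) m :
  (mdeg m <= 2)%N ->
  (a * mpoly_of_dhomog v)@_m = a@_0%MM * (mpoly_of_dhomog v)@_m.
Proof.
move=> dm.
have homv : mpoly_of_dhomog v \is 2.-homog by apply: dhomog_is_dhomog.
pose a' := a - (a@_0)%:MP.
have a'0 : a'@_0 = 0 by rewrite mcoeffB mcoeffC eqxx mulr1 subrr.
rewrite -[a in LHS](subrK (a@_0)%:MP) -/a' mulrDl mcoeffD mcoeffCM mcoeffM.
rewrite big1 ?add0r // => -[m1 m2] /= /eqP mE.
have [->|m1_neq0] := eqVneq (m1 : 'X_{1..e}) 0%MM; first by rewrite a'0 mul0r.
rewrite (dhomog_nemf_coeff homv) ?mulr0 // neq_ltn.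
have /(congr1 mdeg) := mE; rewrite mdegD => dE.
suffices lt_m2 : (mdeg (bmnm m2) < mdeg m)%N by rewrite (leq_trans lt_m2).
by rewrite [X in (_ < X)%N]dE -[X in (X < _)%N]add0n ltn_add2r lt0n mdeg_eq0.
Qed.

(** The ideal generated by [V] is zero below degree 2 and equal to [V] in
    degree 2. *)
Lemma gen_ideal_low (p : {mpoly k[e]}) :
  gen_ideal_prop V p -> exists2 v, v \in V
    & forall m, (mdeg m <= 2)%N -> p@_m = (mpoly_of_dhomog v)@_m.
Proof.
move=> [n [a [v [Vv ->]]]]; exists (\sum_i (a i)@_0 *: v i).
  by apply: memv_suml => i _; apply: memvZ.
move=> m dm; rewrite (raddf_sum (@mpoly_of_dhomog e k 2)) !raddf_sum /=.
by apply: eq_bigr => i _; rewrite mcoeff_lowM // mcoeffZ.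
Qed.

Lemma quad_proj_low (p : {mpoly k[e]}) m :
  proj p = 0 -> (mdeg m < 2)%N -> p@_m = 0.
Proof.
move/quad_proj_eq0/gen_ideal_low=> [v _ pE] dm; rewrite pE ?(ltnW dm) //.
apply: (@dhomog_nemf_coeff _ _ mdeg 2); first exact: dhomog_is_dhomog.
by rewrite neq_ltn dm.
Qed.

Section Basis.
Context (b : (grass_dim e).-tuple (qform k e)).
Hypothesis V_b : basis_of V b.
Local Notation M := (coef_mx b).

Lemma quad_proj_row (a : 'rV_(grass_dim e)) :
  \sum_c (a *m M) 0 c *: proj 'X_[qmon c] = 0 :> R.
Proof.
under eq_bigr => c _ do rewrite -quad_projZ.
rewrite -quad_proj_sum; apply/quad_proj_eq0.
exists (grass_dim e), (fun i => (a 0 i)%:MP), (tnth b); split=> [i|].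
  by apply: (basis_mem V_b); apply: mem_tnth.
under eq_bigr => c _.
  rewrite mxE scaler_suml; under eq_bigr => i _ do rewrite -scalerA mxE.
over.
rewrite exchange_big; apply: eq_bigr => i _; rewrite mul_mpolyC -scaler_sumr.
by congr (_ *: _); rewrite -homog2E //; apply: dhomog_is_dhomog.
Qed.

Lemma quad_proj2_eq0 p : proj p = 0 ->
  exists a : 'rV_(grass_dim e), forall c, p@_(qmon c) = (a *m M) 0 c.
Proof.
move/quad_proj_eq0/gen_ideal_low=> [v Vv pE].
exists (\row_i coord b i v) => c; rewrite pE ?mdeg_qmon //.
rewrite [v in LHS](coord_basis V_b Vv) (raddf_sum (@mpoly_of_dhomog e k 2)).
rewrite raddf_sum mxE; apply: eq_bigr => i _ /=.
by rewrite mcoeffZ !mxE (tnth_nth 0).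
Qed.

End Basis.
End QuadAlg.

(** * Algebras with an exact pair of linear forms *)

(** Here [R] is generated by linear forms [X_0, ..., X_p], and its degree 2
    part is spanned by the products [Z l] of [x = X_0] and [X_(l+1)].  The
    linear form [w] satisfies [x * w = 0], and the matrix [G] of multiplication
    by [w], from the forms [X_(l+1)] to the [Z l], is invertible. *)
Section LinearPair.
Context (k : fieldType) (R : comAlgType k) (p : nat).
Context (X : 'I_p.+1 -> R) (wc : 'I_p.+1 -> k) (G : 'M[k]_p).

Let x := X ord0.
Let X' (l : 'I_p) := X (lift ord0 l).
Let Z l := x * X' l.
Let w := \sum_j wc j *: X j.

Hypothesis XX_span : forall i j, exists t, X i * X j = \sum_l t l *: Z l.
Hypothesis xw0 : x * w = 0.
Hypothesis wXE : forall l, w * X' l = \sum_l' G l l' *: Z l'.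
Hypothesis G_unit : G \in unitmx.

Lemma Z_span_w l : Z l = w * \sum_l' invmx G l l' *: X' l'.
Proof.
rewrite mulr_sumr; under eq_bigr => l' _ do rewrite -scalerAr wXE scaler_sumr.
rewrite exchange_big /= (bigD1 l) //= [X in _ + X]big1 ?addr0 => [|l' nl'].
  under eq_bigr => i _ do rewrite scalerA.
  rewrite -scaler_suml.
  have := congr1 (fun A : 'M_p => A l l) (mulVmx G_unit).
  by rewrite !mxE eqxx => ->; rewrite scale1r.
under eq_bigr => i _ do rewrite scalerA.
rewrite -scaler_suml.
have := congr1 (fun A : 'M_p => A l l') (mulVmx G_unit).
by rewrite !mxE eq_sym (negPf nl') => ->; rewrite scale0r.
Qed.

(** [Z l] is a multiple of [w], which is killed by [x]. *)
Lemma xZ0 l : x * Z l = 0.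
Proof. by rewrite Z_span_w mulrA xw0 mul0r. Qed.

Lemma XZ0 i l : X i * Z l = 0.
Proof.
rewrite mulrCA; have [t ->] := XX_span i (lift ord0 l).
by rewrite mulr_sumr big1 // => j _; rewrite -scalerAr xZ0 scaler0.
Qed.

Lemma cube_zero i j l : X i * (X j * X l) = 0.
Proof.
have [t ->] := XX_span j l.
by rewrite mulr_sumr big1 // => s _; rewrite -scalerAr XZ0 scaler0.
Qed.

Lemma ZZ0 l l' : Z l * Z l' = 0.
Proof. by rewrite -mulrA XZ0 mulr0. Qed.

(* From now on 1, the X j and the Z l form a basis of R, and w involves X_0. *)
Hypothesis wc0 : wc ord0 != 0.
Hypothesis nf_span : forall u : R, exists c a b,
  u = c%:A + \sum_j a j *: X j + \sum_l b l *: Z l.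
Hypothesis nf_indep : forall c a b,
  c%:A + \sum_j a j *: X j + \sum_l b l *: Z l = 0 ->
  [/\ c = 0, forall j, a j = 0 & forall l, b l = 0].

(* The maximal ideal generated by the linear forms. *)
Let in_m (u : R) := exists a b, u = \sum_j a j *: X j + \sum_l b l *: Z l.

Lemma in_mZ0 u l : in_m u -> u * Z l = 0.
Proof.
move=> [a [b ->]]; rewrite mulrDl !mulr_suml !big1 ?addr0 // => j _.
  by rewrite -scalerAl ZZ0 scaler0.
by rewrite -scalerAl XZ0 scaler0.
Qed.

Lemma in_mX u j : in_m u -> exists t, u * X j = \sum_l t l *: Z l.
Proof.
move=> [a [b ->]]; have [t tE] := fin_all_exists (fun i => XX_span i j).
exists (fun l => \sum_i a i * t i l); rewrite mulrDl.
rewrite [X in _ + X](_ : _ = 0) ?addr0; last first.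
  by rewrite mulr_suml big1 // => l _; rewrite -scalerAl mulrC XZ0 scaler0.
under [RHS]eq_bigr => l _ do rewrite scaler_suml.
rewrite exchange_big mulr_suml; apply: eq_bigr => i _.
by rewrite -scalerAl tE scaler_sumr; apply: eq_bigr => l _; rewrite scalerA.
Qed.

Lemma in_m_cube u : in_m u -> u ^+ 3 = 0.
Proof.
move=> mu; have [a [b uE]] := mu.
rewrite exprS expr2 {3}uE !mulrDr !mulr_sumr !big1 ?addr0 // => [l|j] _.
  by rewrite -scalerAr (in_mZ0 _ mu) scaler0 mulr0.
rewrite -scalerAr; have [t ->] := in_mX j mu.
rewrite -scalerAr mulr_sumr big1 ?scaler0 // => l _.
by rewrite -scalerAr (in_mZ0 _ mu) scaler0.
Qed.

Lemma in_m_local u : in_m u \/ exists v, v * u = 1.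
Proof.
have [c [a [b ->]]] := nf_span u; rewrite -addrA.
set v := _ + \sum_l _; have mv : in_m v by exists a, b.
have [->|c_neq0] := eqVneq c 0; first by left; rewrite scale0r add0r.
right; pose q := c^-1 *: v.
have q3 : q ^+ 3 = 0 by rewrite exprZn in_m_cube // scaler0.
have -> : c%:A + v = c *: (1 + q) by rewrite scalerDr scalerA divff ?scale1r.
exists (c^-1 *: (1 - q + q ^+ 2)).
rewrite -scalerAl -scalerAr scalerA mulVf // scale1r.
have -> : (1 - q + q ^+ 2) * (1 + q) = 1 + q ^+ 3 by ring.
by rewrite q3 addr0.
Qed.

Lemma linear_Z_indep c d (a : 'I_p.+1 -> k) b :
    c%:A + d *: (\sum_j a j *: X j) + \sum_l b l *: Z l = 0 ->
  [/\ c = 0, forall j, d * a j = 0 & forall l, b l = 0].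
Proof.
rewrite scaler_sumr; under [X in _ + X + _]eq_bigr => j _ do rewrite scalerA.
exact: nf_indep.
Qed.

Lemma x_expansion : x = \sum_j (j == ord0)%:R *: X j.
Proof.
rewrite (bigD1 ord0) //= scale1r big1 ?addr0 // => j /negPf->.
by rewrite scale0r.
Qed.

Lemma x_Z_indep c d b : c%:A + d *: x + \sum_l b l *: Z l = 0 ->
  [/\ c = 0, d = 0 & forall l, b l = 0].
Proof.
rewrite x_expansion => /linear_Z_indep[-> /(_ ord0)/eqP + b0].
by rewrite mulr1 => /eqP.
Qed.

Lemma w_Z_indep d b : d *: w + \sum_l b l *: Z l = 0 ->
  d = 0 /\ forall l, b l = 0.
Proof.
move=> dwb0; have [|_ /(_ ord0)/eqP + b0] := @linear_Z_indep 0 d wc b.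
  by rewrite scale0r add0r.
by rewrite mulf_eq0 (negPf wc0) orbF => /eqP.
Qed.

Lemma Z_expansion l0 : Z l0 = \sum_l (l == l0)%:R *: Z l.
Proof.
rewrite (bigD1 l0) //= eqxx scale1r big1 ?addr0 // => l /negPf->.
by rewrite scale0r.
Qed.

Let sumZ0 : \sum_l 0 *: Z l = 0 :> R.
Proof. by rewrite big1 // => l _; rewrite scale0r. Qed.

Lemma x_neq0 : x != 0.
Proof.
apply/eqP => x0; have [|_ /eqP] := @x_Z_indep 0 1 (fun=> 0).
  by rewrite sumZ0 x0 scaler0 scale0r !addr0.
by rewrite oner_eq0.
Qed.

Lemma w_neq0 : w != 0.
Proof.
apply/eqP => w0; have [|/eqP] := @w_Z_indep 1 (fun=> 0).
  by rewrite sumZ0 w0 scaler0 addr0.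
by rewrite oner_eq0.
Qed.

Lemma sum_Z_multiple (v : R) (b : 'I_p -> k) :
    (forall l, exists z, Z l = z * v) ->
  exists z, \sum_l b l *: Z l = z * v.
Proof.
move=> Zv; elim/big_ind: _ => [|_ _ [y ->] [z ->]|l _].
- by exists 0; rewrite mul0r.
- by exists (y + z); rewrite mulrDl.
- by have [z ->] := Zv l; exists (b l *: z); rewrite scalerAl.
Qed.

Lemma ann_x_w : ann_eq_principal x w.
Proof.
move=> u; split=> [ux0|[z ->]]; last by rewrite -mulrA [w * x]mulrC xw0 mulr0.
have [c [a [b uE]]] := nf_span u.
(* Eliminate the X_0-coordinate of u by a multiple of w. *)
pose s := a ord0 / wc ord0.
pose a' l := a (lift ord0 l) - s * wc (lift ord0 l).
have {}uE : u = c%:A + s *: w + \sum_l a' l *: X' l + \sum_l b l *: Z l.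
  rewrite uE -!addrA; congr (_ + _); rewrite !addrA; congr (_ + _).
  rewrite scaler_sumr !big_ord_recl scalerA divfK // -addrA; congr (_ + _).
  rewrite -big_split; apply: eq_bigr => l _ /=.
  by rewrite scalerA -scalerDl addrC subrK.
have [_ c0 a'0] : [/\ 0 = 0 :> k, c = 0 & forall l, a' l = 0].
  apply: x_Z_indep; rewrite scale0r add0r -[RHS]ux0 uE !mulrDl -!scalerAl mul1r.
  rewrite [w * x]mulrC xw0 scaler0 addr0 !mulr_suml.
  rewrite [X in _ = _ + _ + X]big1 ?addr0 => [|l _].
    by congr (_ + _); apply: eq_bigr => l _; rewrite -scalerAl [X' l * x]mulrC.
  by rewrite -scalerAl mulrC xZ0 scaler0.
rewrite uE; have [|z ->] := @sum_Z_multiple w b.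
  by move=> l; eexists; rewrite Z_span_w mulrC.
exists (s%:A + z); rewrite big1 => [|l _]; last by rewrite a'0 scale0r.
by rewrite c0 scale0r add0r addr0 mulrDl -scalerAl mul1r.
Qed.

Lemma ann_w_x : ann_eq_principal w x.
Proof.
move=> u; split=> [uw0|[z ->]]; last by rewrite -mulrA xw0 mulr0.
have [c [a [b uE]]] := nf_span u.
pose a' := \row_l a (lift ord0 l).
have {}uE : u = c%:A + a ord0 *: x + \sum_l a' 0 l *: X' l + \sum_l b l *: Z l.
  rewrite uE big_ord_recl addrA; congr (_ + _ + _).
  by apply: eq_bigr => l _; rewrite mxE.
have [c0 a'G0] : c = 0 /\ forall l, (a' *m G) 0 l = 0.
  apply: w_Z_indep; rewrite -[RHS]uw0 uE !mulrDl -!scalerAl mul1r.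
  rewrite xw0 scaler0 addr0 !mulr_suml.
  rewrite [X in _ = _ + _ + X]big1 ?addr0 => [|l _].
    congr (_ + _); under eq_bigr => l _ do rewrite mxE scaler_suml.
    rewrite exchange_big; apply: eq_bigr => l _ /=.
    rewrite -scalerAl [X' l * w]mulrC wXE scaler_sumr.
    by apply: eq_bigr => l' _; rewrite scalerA.
  rewrite -scalerAl mulr_sumr big1 ?scaler0 // => j _.
  by rewrite -scalerAr mulrC XZ0 scaler0.
have a'0 : a' = 0.
  rewrite -[a'](mulmxK G_unit) (_ : a' *m G = 0) ?mul0mx //.
  by apply/rowP => l; rewrite a'G0 mxE.
rewrite uE c0 a'0; have [|z ->] := @sum_Z_multiple x b.
  by move=> l; exists (X' l); rewrite mulrC.
exists ((a ord0)%:A + z); rewrite big1 => [|l _]; last by rewrite mxE scale0r.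
by rewrite scale0r add0r addr0 mulrDl -scalerAl mul1r.
Qed.

Lemma linear_exact_zero_divisor : exact_zero_divisor x.
Proof.
split; first exact: x_neq0.
  case=> y yx; have /eqP[] := w_neq0.
  by rewrite -[w]mul1r -yx -mulrA xw0 mulr0.
by exists w; split; [exact: ann_x_w | exact: ann_w_x].
Qed.

Lemma linear_not_gorenstein : (1 < p)%N -> ~ gorenstein R.
Proof.
move=> p_gt1.
pose l0 : 'I_p := Ordinal (ltnW p_gt1); pose l1 : 'I_p := Ordinal p_gt1.
pose ZX := codom X ++ codom Z.
apply: (@not_gorenstein_two_socle _ in_m (Z l0) _ _ _ (Z l1) (1 :: ZX)).
- exact: in_m_local.
- apply/eqP => Z0.
  have [|_ /(_ l0)/eqP] := @w_Z_indep 0 (fun l => (l == l0)%:R).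
    by rewrite scale0r add0r -[RHS]Z0 -Z_expansion.
  by rewrite eqxx oner_eq0.
- by move=> a; apply: in_mZ0.
- rewrite cat_cons -catA; split.
    move=> _ [a [b ->]]; rewrite mulr1; apply: seq_idealD1.
      under eq_bigr => j _ do rewrite -[X j]mul1r scalerAl.
      by apply: seq_ideal_sum => j; rewrite mem_cat codom_f.
    under eq_bigr => l _ do rewrite -[Z l]mul1r scalerAl.
    by apply: seq_ideal_sum => l; rewrite !mem_cat codom_f orbT.
  apply: socle_flag_cat => [_ a /codomP[j ->] ma|].
    have [t ->] := in_mX j ma.
    under eq_bigr => l _ do rewrite -[Z l]mul1r scalerAl.
    by apply: seq_ideal_sum => l; rewrite mem_cat codom_f.
  apply: socle_flag_cat => [_ a /codomP[l ->] ma|].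
    by rewrite in_mZ0 //; apply: seq_ideal0.
  by split=> // a ma; rewrite /= in_mZ0.
- by apply: mem_seq_ideal; rewrite mem_head.
- by move=> a; apply: in_mZ0.
- move=> y; have [c [a [b ->]]] := nf_span y.
  rewrite -addrA mulrDl [X in _ + X]in_mZ0; last by exists a, b.
  rewrite addr0 -scalerAl mul1r => /eqP; rewrite -subr_eq0 => /eqP Zc.
  have [|_ /(_ l1)/eqP] :=
    @w_Z_indep 0 (fun l => (l == l1)%:R - c * (l == l0)%:R).
    rewrite scale0r add0r -[RHS]Zc [Z l1]Z_expansion [Z l0 in RHS]Z_expansion.
    rewrite scaler_sumr -sumrB; apply: eq_bigr => l _.
    by rewrite scalerBl scalerA.
  by rewrite eqxx mulr0 subr0 oner_eq0.
Qed.

End LinearPair.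

(** * The chart of the Grassmannian *)

(** With [p.+1] variables, the pivot columns are those of the monomials other
    than the [X_0 X_(l+1)]. *)
Section ChartColumns.
Context (p : nat).
Local Notation e := p.+1.

(** The column of [X_0 X_(l+1)]. *)
Definition x0col (l : 'I_p) : 'I_(qform_dim e) := qcol ord0 (lift ord0 l).

Lemma x0col_inj : injective x0col.
Proof.
move=> l l' /(congr1 (@qmon e)); rewrite !qmon_qcol => /mnmP/(_ (lift ord0 l)).
rewrite !mnmDE !mnm1E eqxx => /addnI.
by rewrite (inj_eq lift_inj); case: eqP => // ->.
Qed.

Lemma grass_dimE : (grass_dim e + p = qform_dim e)%N.
Proof.
rewrite /grass_dim /qform_dim.
have -> : (e ^ 2 - e + 2 = p * p + p + 2)%N by lia.
have -> : (e * e.+1 = p * p + p + 2 + p.*2)%N by lia.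
by rewrite [RHS]halfD odd_double andbF add0n doubleK.
Qed.

Lemma card_chart : #|~: [set x0col l | l : 'I_p]| = grass_dim e.
Proof.
rewrite cardsCs setCK card_imset ?card_ord; last exact: x0col_inj.
by rewrite -grass_dimE addnK.
Qed.

Lemma chart_columns : exists r0 : 'I_(grass_dim e) -> 'I_(qform_dim e),
  [/\ injective r0, forall i l, r0 i != x0col l
    & forall c, (exists i, c = r0 i) \/ exists l, c = x0col l].
Proof.
exists (fun i => enum_val (cast_ord (esym card_chart) i)); split.
- by move=> i j /enum_val_inj/cast_ord_inj.
- move=> i l.
  apply: contraTneq (enum_valP (cast_ord (esym card_chart) i)) => ->.
  by rewrite inE negbK imset_f.
- move=> c; have [/imsetP[l _ ->]|] := boolP (c \in [set x0col l | l : 'I_p]).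
    by right; exists l.
  rewrite -in_setC => cB; left.
  exists (cast_ord card_chart (enum_rank_in cB c)).
  by rewrite cast_ordK enum_rankK_in.
Qed.

End ChartColumns.

(** The matrix [N] is meant to be [delta] times a matrix in reduced row echelon
    form, with pivot columns [r0], and [i0] to be the row with pivot [X_0 ^ 2];
    the following expressions are then homogeneous in [N] and [delta].  They
    make sense over any commutative ring, so that they can be evaluated both at
    linear forms and at their values. *)
Section ChartAlgebra.
Context (p : nat) (K : comNzRingType).
Local Notation e := p.+1.
Local Notation n := (grass_dim e).
Local Notation m := (qform_dim e).
Context (r0 : 'I_n -> 'I_m) (i0 : 'I_n).
Context (N : 'M[K]_(n, m)) (delta : K).

(** The coefficient of [X_0 X_(l+1)] in [delta] times the reduction modulo the
    rows of [N] of the monomial of column [c]. *)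
Definition red_coef (c : 'I_m) (l : 'I_p) : K :=
  delta *+ (c == x0col l) - \sum_i N i (x0col l) *+ (c == r0 i).

(** The coefficients of the linear form [w] such that [X_0 * w] is the row [i0]
    of [N]. *)
Definition partner_coef (j : 'I_e) : K := N i0 (qcol ord0 j).

(** The matrix of [delta] times the multiplication by [w], from the [X_(l+1)]
    to the [X_0 X_(l+1)]. *)
Definition partner_mx : 'M[K]_p :=
  \matrix_(l, l') \sum_j partner_coef j * red_coef (qcol j (lift ord0 l)) l'.

(** The form whose nonvanishing defines the open set. *)
Definition chart_form : K := delta * \det partner_mx.

End ChartAlgebra.

Section ChartMorphism.
Context (p : nat) (r0 : 'I_(grass_dim p.+1) -> 'I_(qform_dim p.+1)).
Context (i0 : 'I_(grass_dim p.+1)).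

Lemma chart_form_morph (K L : comNzRingType) (f : {rmorphism K -> L}) N delta :
  chart_form r0 i0 (map_mx f N) (f delta) = f (chart_form r0 i0 N delta).
Proof.
rewrite /chart_form rmorphM -det_map_mx; congr (_ * \det _).
apply/matrixP=> l l'; rewrite !mxE rmorph_sum; apply: eq_bigr => j _ /=.
rewrite rmorphM /partner_coef mxE; congr (_ * _).
rewrite /red_coef rmorphB rmorphMn rmorph_sum /=; congr (_ - _).
by apply: eq_bigr => i _; rewrite mxE rmorphMn.
Qed.

Lemma chart_form_scale (K : comNzRingType) (a : K) N delta :
  chart_form r0 i0 (a *: N) (a * delta) =
  a * (a ^+ 2) ^+ p * chart_form r0 i0 N delta.
Proof.
have redZ c l :
    red_coef r0 (a *: N) (a * delta) c l = a * red_coef r0 N delta c l.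
  rewrite /red_coef mulrBr mulr_sumr mulrnAr; congr (_ - _).
  by apply: eq_bigr => i _; rewrite mxE mulrnAr.
rewrite /chart_form.
rewrite (_ : partner_mx _ _ _ _ = a ^+ 2 *: partner_mx r0 i0 N delta).
  by rewrite detZ mulrACA.
apply/matrixP=> l l'; rewrite !mxE mulr_sumr; apply: eq_bigr => j _.
by rewrite redZ /partner_coef mxE mulrACA.
Qed.

Lemma dhomog_sum_in (k : fieldType) n d (J : finType) (F : J -> {mpoly k[n]}) :
  (forall j, F j \is d.-homog) -> \sum_j F j \is d.-homog.
Proof. by move=> homF; apply: rpred_sum => j _. Qed.

Lemma dhomog_det (k : fieldType) n d q (A : 'M[{mpoly k[n]}]_q) :
  (forall i j, A i j \is d.-homog) -> \det A \is (q * d).-homog.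
Proof.
move=> homA; apply: dhomog_sum_in => s; rewrite rpredMsign.
have homP (r : seq 'I_q) : \prod_(i <- r) A i (s i) \is (size r * d).-homog.
  elim: r => [|i r IHr]; first by rewrite big_nil dhomog1.
  by rewrite big_cons mulSn; apply: dhomogM.
have sz : size (index_enum 'I_q) = q.
  by rewrite [index_enum _]unlock -enumT size_enum_ord.
by have := homP (index_enum 'I_q); rewrite sz.
Qed.

Lemma dhomog_chart_form (k : fieldType) n (N : 'M[{mpoly k[n]}]_(_, _)) delta :
    (forall i j, N i j \is 1.-homog) -> delta \is 1.-homog ->
  chart_form r0 i0 N delta \is (1 + p * 2).-homog.
Proof.
move=> homN homd; apply: dhomogM => //; apply: dhomog_det => l l'.
rewrite mxE; apply: dhomog_sum_in => j; apply: (@dhomogM _ _ _ 1 _ 1) => //.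
  exact: homN.
apply: rpredB; first exact: rpredMn.
by apply: rpred_sum => i _; apply: rpredMn; apply: homN.
Qed.

End ChartMorphism.

(** Cramer's rule: up to the determinant of the pivot columns, the entries of
    the reduced matrix are the minors with one pivot column exchanged. *)
Lemma adj_mul_minor (K : comNzRingType) n m (g : 'I_n -> 'I_m)
    (M : 'M[K]_(n, m)) i j :
  (\adj (colsub g M) *m M) i j =
  \det (colsub (fun i' => if i' == i then j else g i') M).
Proof.
rewrite (expand_det_col _ i) mxE; apply: eq_bigr => a _.
rewrite !mxE eqxx mulrC; congr (_ * _); rewrite /cofactor; congr (_ * \det _).
apply/matrixP=> c d.
by rewrite !mxE [lift i d == i]eq_sym (negPf (neq_lift _ _)).
Qed.

Section ChartValue.
Context (k : fieldType) (p : nat).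
Context (r0 : 'I_(grass_dim p.+1) -> 'I_(qform_dim p.+1)).
Context (i0 : 'I_(grass_dim p.+1)).

(** The value of [chart_form] at the reduction of [M], with denominators
    cleared by the adjugate of the pivot columns. *)
Definition chart_value (M : 'M[k]_(grass_dim p.+1, qform_dim p.+1)) : k :=
  chart_form r0 i0 (\adj (colsub r0 M) *m M) (\det (colsub r0 M)).

Lemma chart_value_mul A M :
  chart_value (A *m M) = \det A * (\det A ^+ 2) ^+ p * chart_value M.
Proof.
rewrite -chart_form_scale /chart_value -mulmx_colsub det_mulmx.
congr (chart_form _ _ _ _); apply/matrixP=> i j.
by rewrite mulmx_colsub adj_mul_minor -mulmx_colsub det_mulmx mxE adj_mul_minor.
Qed.

Lemma chart_value_plucker :
  exists2 F : {mpoly k['C(qform_dim p.+1, grass_dim p.+1)]},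
    F \is (1 + p * 2).-homog
    & forall b, chart_value (coef_mx b) = F.@[@plucker_coord k p.+1 b].
Proof.
pose g i j i' := if i' == i then j else r0 i'.
have /fin_all_exists2[L homL LE] := fun i => fin_all_exists2 (fun j =>
  det_colsub_plucker k (g i j)).
have [D homD DE] := det_colsub_plucker k r0.
exists (chart_form r0 i0 (\matrix_(i, j) L i j) D).
  by apply: dhomog_chart_form => // i j; rewrite mxE.
move=> b; rewrite -chart_form_morph /chart_value DE.
congr (chart_form _ _ _ _); apply/matrixP=> i j.
by rewrite adj_mul_minor !mxE -[colsub _ _]/(colsub (g i j) _) LE.
Qed.

End ChartValue.

(** * Algebras in the chart *)

Lemma sum_scaleD (k : nzRingType) (L : lmodType k) (J : finType) c
    (a a' : J -> k) (F : J -> L) :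
  \sum_j (c * a j + a' j) *: F j =
  c *: (\sum_j a j *: F j) + \sum_j a' j *: F j.
Proof.
rewrite scaler_sumr -big_split; apply: eq_bigr => j _ /=.
by rewrite scalerA scalerDl.
Qed.

Section ProjSpan.
Context (k : fieldType) (e : nat) (V : {vspace qform k e}).
Local Notation R := (quad_alg V).
Local Notation proj := (@quad_proj k e V).

Lemma proj_ind (P : R -> Prop) (q : {mpoly k[e]}) :
    P 0 -> (forall c u v, P u -> P v -> P (c *: u + v)) ->
    (forall m, m \in msupp q -> P (proj 'X_[m])) ->
  P (proj q).
Proof.
move=> P0 PD PX; rewrite [q]mpolyE.
have : {subset msupp q <= msupp q} by [].
elim: {-2}(msupp q) => [|m s IHs] ssub.
  by rewrite big_nil quad_proj0.
rewrite big_cons quad_projD quad_projZ; apply: PD.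
  by apply/PX/ssub; rewrite mem_head.
by apply: IHs => m' m's; apply: ssub; rewrite inE m's orbT.
Qed.

Lemma graded_piece_span i d (b : 'I_d -> R) :
    (forall m, mdeg m = i -> exists a, proj 'X_[m] = \sum_j a j *: b j) ->
  forall u, graded_piece i u -> exists a, u = \sum_j a j *: b j.
Proof.
move=> bX _ [q homq ->].
apply: (@proj_ind (fun u => exists a, u = \sum_j a j *: b j)).
- by exists (fun=> 0); rewrite big1 // => j _; rewrite scale0r.
- move=> c _ _ [a ->] [a' ->]; exists (fun j => c * a j + a' j).
  by rewrite sum_scaleD.
- by move=> m mq; apply: bX; move/dhomogP: homq; apply.
Qed.
End ProjSpan.

Lemma sum_codom (W : nmodType) (I J : finType) (F : J -> W) (h : I -> J) :
  injective h -> \sum_(c | c \in codom h) F c = \sum_i F (h i).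
Proof.
move=> h_inj; have -> : \sum_i F (h i) = \sum_(c <- codom h) F c.
  by rewrite big_map big_enum.
by rewrite big_uniq // map_inj_uniq ?enum_uniq.
Qed.

(** The quotient by a subspace [V] with coefficient matrix [M] at which the
    chart form does not vanish satisfies the hypotheses made above on linear
    forms: [Y c] is the class of the monomial of column [c], and [G] the matrix
    of multiplication by [w]. *)
Section ChartPoint.
Context (k : fieldType) (p : nat).
Context (r0 : 'I_(grass_dim p.+1) -> 'I_(qform_dim p.+1)).
Context (i0 : 'I_(grass_dim p.+1)).
Hypothesis r0_inj : injective r0.
Hypothesis r0_neq_x0col : forall i l, r0 i != x0col l.
Hypothesis colP : forall c, (exists i, c = r0 i) \/ exists l, c = @x0col p l.
Hypothesis r0i0 : r0 i0 = qcol ord0 ord0.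

Lemma sum_cols (W : nmodType) (F : 'I_(qform_dim p.+1) -> W) :
  \sum_c F c = \sum_i F (r0 i) + \sum_l F (x0col l).
Proof.
rewrite (bigID (fun c => c \in codom r0)) /= sum_codom //; congr (_ + _).
rewrite -(sum_codom _ (@x0col_inj p)); apply: eq_bigl => c.
have [[i ->]|[l ->]] := colP c.
  rewrite codom_f; apply/esym/negbTE/negP => /codomP[l /eqP].
  by rewrite (negPf (r0_neq_x0col _ _)).
rewrite codom_f; apply/negP => /codomP[i /eqP].
by rewrite eq_sym (negPf (r0_neq_x0col _ _)).
Qed.

Context (V : {vspace qform k p.+1}).
Context (b : (grass_dim p.+1).-tuple (qform k p.+1)).
Hypothesis V_b : basis_of V b.
Hypothesis chart_neq0 : chart_value r0 i0 (coef_mx b) != 0.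

Local Notation R := (quad_alg V).
Local Notation proj := (@quad_proj k p.+1 V).

Let M := coef_mx b.
Let C := colsub r0 M.
Let N := \adj C *m M.
Let delta := \det C.
Let X j : R := proj 'X_j.
Let Y c : R := proj 'X_[qmon c].
Let Z l : R := X ord0 * X (lift ord0 l).
Let wc := partner_coef i0 N.
Let G := delta^-1 *: partner_mx r0 i0 N delta.

Lemma delta_neq0 : delta != 0.
Proof. by move: chart_neq0; rewrite mulf_eq0 => /norP[]. Qed.

Lemma G_unit : G \in unitmx.
Proof.
rewrite unitmxZ ?unitfE ?invr_eq0 ?delta_neq0 // unitmxE unitfE.
by move: chart_neq0; rewrite mulf_eq0 => /norP[].
Qed.

Lemma XX_Y i j : X i * X j = Y (qcol i j).
Proof. by rewrite -quad_projM -mpolyXD -qmon_qcol. Qed.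

(** The rows of [N] are combinations of those of [M], hence forms in [V]. *)
Lemma N_row i : \sum_c N i c *: Y c = 0.
Proof.
rewrite -[RHS](quad_proj_row V_b (row i (\adj C))).
by apply: eq_bigr => c _; rewrite -row_mul [in RHS]mxE.
Qed.

Lemma N_r0 i i' : N i (r0 i') = delta *+ (i == i').
Proof.
have -> : N i (r0 i') = colsub r0 N i i' by rewrite [RHS]mxE.
by rewrite /N -mulmx_colsub mul_adj_mx mxE.
Qed.

Lemma N_row_r0 i : delta *: Y (r0 i) + \sum_l N i (x0col l) *: Z l = 0.
Proof.
rewrite -[RHS](N_row i) sum_cols; congr (_ + _); last first.
  by apply: eq_bigr => l _; rewrite /Z XX_Y.
rewrite (bigD1 i) //= N_r0 eqxx big1 ?addr0 // => i' ni'.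
by rewrite N_r0 eq_sym (negPf ni') scale0r.
Qed.

Lemma Y_red c : delta *: Y c = \sum_l red_coef r0 N delta c l *: Z l.
Proof.
have [[i ->]|[l0 ->]] := colP c.
  apply/eqP; rewrite -subr_eq0 -sumrN; apply/eqP.
  rewrite -[RHS](N_row_r0 i); congr (_ + _); apply: eq_bigr => l _.
  rewrite -scaleNr /red_coef (negPf (r0_neq_x0col _ _)) sub0r opprK.
  congr (_ *: _); rewrite (bigD1 i) //= eqxx big1 ?addr0 // => i' ni'.
  by rewrite (inj_eq r0_inj) eq_sym (negPf ni').
rewrite (bigD1 l0) //= [X in _ + X]big1 => [|l nl]; last first.
  rewrite /red_coef (inj_eq (@x0col_inj p)) eq_sym (negPf nl) sub0r big1.
    by rewrite oppr0 scale0r.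
  by move=> i _; rewrite eq_sym (negPf (r0_neq_x0col _ _)).
rewrite /red_coef eqxx [X in _ - X]big1 ?subr0 ?addr0 /Z ?XX_Y // => i _.
by rewrite eq_sym (negPf (r0_neq_x0col _ _)).
Qed.

Lemma XX_span i j : exists t, X i * X j = \sum_l t l *: Z l.
Proof.
exists (fun l => delta^-1 * red_coef r0 N delta (qcol i j) l).
under eq_bigr => l _ do rewrite -scalerA.
by rewrite -scaler_sumr -Y_red scalerA mulVf ?delta_neq0 // scale1r XX_Y.
Qed.

Lemma wc0 : wc ord0 = delta.
Proof. by rewrite /wc /partner_coef -r0i0 N_r0 eqxx. Qed.

Lemma xw0 : X ord0 * (\sum_j wc j *: X j) = 0.
Proof.
rewrite mulr_sumr big_ord_recl -scalerAr wc0 XX_Y -r0i0 -[RHS](N_row_r0 i0).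
by congr (_ + _); apply: eq_bigr => l _; rewrite -scalerAr.
Qed.

Lemma wXE l :
  (\sum_j wc j *: X j) * X (lift ord0 l) = \sum_l' G l l' *: Z l'.
Proof.
rewrite mulr_suml; under [RHS]eq_bigr => l' _.
  rewrite mxE mxE -scalerA scaler_suml.
over.
rewrite -scaler_sumr exchange_big scaler_sumr; apply: eq_bigr => j _ /=.
under eq_bigr => l' _ do rewrite -scalerA.
rewrite -scaler_sumr -Y_red !scalerA mulrCA mulVf ?delta_neq0 // mulr1.
by rewrite -scalerAl XX_Y.
Qed.

Lemma wc0_neq0 : wc ord0 != 0.
Proof. by rewrite wc0 delta_neq0. Qed.

Let XXX0 := cube_zero XX_span xw0 wXE G_unit.

Lemma proj_deg1 m : mdeg m = 1%N -> exists j, proj 'X_[m] = X j.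
Proof.
case/mnm_factor=> j [m' [-> /eqP]]; rewrite mdeg_eq0 => /eqP->.
by exists j; rewrite addm0.
Qed.

Lemma proj_deg2 m :
  mdeg m = 2%N -> exists t, proj 'X_[m] = \sum_l t l *: Z l.
Proof.
case/mnm_factor=> i [m' [-> /proj_deg1[j m'E]]].
by rewrite mpolyXD quad_projM m'E; apply: XX_span.
Qed.

Lemma proj_deg3 m : (2 < mdeg m)%N -> proj 'X_[m] = 0.
Proof.
case dm : (mdeg m) => [|[|[|d]]] // _.
have [i [m1 [-> dm1]]] := mnm_factor dm.
have [j [m2 [-> dm2]]] := mnm_factor dm1.
have [l [m3 [-> _]]] := mnm_factor dm2.
rewrite !mpolyXD !quad_projM ![_ * (_ * proj 'X_[m3])]mulrA.
by have := XXX0 i j l; rewrite /X !mulrA => ->; rewrite mul0r.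
Qed.

Lemma nf_span (u : R) : exists c a t,
  u = c%:A + \sum_j a j *: X j + \sum_l t l *: Z l.
Proof.
have [q ->] := quad_projP u.
apply: (@proj_ind _ _ _ (fun u => exists c a t,
  u = c%:A + \sum_j a j *: X j + \sum_l t l *: Z l)) => [|c u1 u2|m _].
- exists 0, (fun=> 0), (fun=> 0).
  by rewrite scale0r !big1 ?addr0 // => j _; rewrite scale0r.
- move=> [c1 [a1 [t1 ->]]] [c2 [a2 [t2 ->]]].
  exists (c * c1 + c2), (fun j => c * a1 j + a2 j), (fun l => c * t1 l + t2 l).
  rewrite !sum_scaleD scalerDl -scalerA !scalerDr.
  by rewrite addrACA [X in X + _]addrACA.
have sum0 (J : finType) (F : J -> R) : \sum_j 0 *: F j = 0.
  by rewrite big1 // => j _; rewrite scale0r.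
case dm : (mdeg m) => [|[|[|d]]].
- move/eqP: dm; rewrite mdeg_eq0 => /eqP->.
  exists 1, (fun=> 0), (fun=> 0).
  by rewrite mpolyX0 quad_proj1 !sum0 scale1r !addr0.
- have [j ->] := proj_deg1 dm; exists 0, (fun i => (i == j)%:R), (fun=> 0).
  rewrite sum0 scale0r add0r addr0 (bigD1 j) //= eqxx scale1r big1 ?addr0 //.
  by move=> i /negPf->; rewrite scale0r.
- have [t ->] := proj_deg2 dm; exists 0, (fun=> 0), t.
  by rewrite sum0 scale0r !add0r.
- exists 0, (fun=> 0), (fun=> 0); rewrite proj_deg3 ?dm //.
  by rewrite !sum0 scale0r !addr0.
Qed.

Lemma nf_indep c a t :
    c%:A + \sum_j a j *: X j + \sum_l t l *: Z l = 0 ->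
  [/\ c = 0, forall j, a j = 0 & forall l, t l = 0].
Proof.
pose q : {mpoly k[p.+1]} := c%:MP + \sum_j a j *: 'X_j
   + \sum_l t l *: 'X_[qmon (x0col l)].
have -> : c%:A + \sum_j a j *: X j + \sum_l t l *: Z l = proj q.
  rewrite !quad_projD !quad_proj_sum; congr (_ + _ + _).
  - by rewrite -[c%:MP]mulr1 mul_mpolyC quad_projZ quad_proj1.
  - by apply: eq_bigr => j _; rewrite quad_projZ.
  - by apply: eq_bigr => l _; rewrite quad_projZ /Z XX_Y.
move=> q0.
have qE m : q@_m = c * (m == 0%MM)%:R + \sum_j a j * (U_(j)%MM == m)%:R
     + \sum_l t l * (qmon (x0col l) == m)%:R.
  rewrite !mcoeffD mcoeffC !raddf_sum /=.
  by congr (_ + _ + _); apply: eq_bigr => j _; rewrite mcoeffZ mcoeffX.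
have mnm1_inj (i j : 'I_p.+1) : (U_(i)%MM == U_(j)%MM) = (i == j).
  apply/eqP/eqP => [/mnmP/(_ j)|-> //].
  by rewrite !mnm1E eqxx; case: eqP.
have degF (m1 m2 : 'X_{1..p.+1}) : mdeg m1 != mdeg m2 -> (m1 == m2) = false.
  by move=> nd; apply: contraNF nd => /eqP->.
have c0 : c = 0.
  have := quad_proj_low q0 (_ : mdeg 0%MM < 2)%N.
  rewrite mdeg0 qE eqxx mulr1 => <- //.
  rewrite !big1 ?addr0 // => j _; rewrite degF ?mulr0 //.
    by rewrite mdeg_qmon mdeg0.
  by rewrite mdeg1 mdeg0.
have a0 j : a j = 0.
  have := quad_proj_low q0 (_ : mdeg U_(j)%MM < 2)%N; rewrite mdeg1 qE => <- //.
  rewrite c0 mul0r add0r (bigD1 j) //= eqxx mulr1 !big1 ?addr0 // => i.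
    by rewrite degF ?mulr0 // mdeg_qmon mdeg1.
  by move=> ij; rewrite mnm1_inj (negPf ij) mulr0.
split=> // l.
have [alpha aE] := quad_proj2_eq0 V_b q0.
have qcE c' : (alpha *m M) 0 c' = \sum_l' t l' *+ (x0col l' == c').
  rewrite -aE qE c0 mul0r add0r big1 ?add0r => [|j _]; last by rewrite a0 mul0r.
  by apply: eq_bigr => l' _; rewrite (inj_eq (@qmon_inj _)) mulr_natr.
have alpha0 : alpha = 0.
  have C_unit : C \in unitmx by rewrite unitmxE unitfE delta_neq0.
  rewrite -[alpha](mulmxK C_unit) (_ : alpha *m C = 0) ?mul0mx //.
  apply/rowP => i; rewrite mulmx_colsub mxE qcE [RHS]mxE big1 // => l' _.
  by rewrite eq_sym (negPf (r0_neq_x0col _ _)).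
have := qcE (x0col l).
rewrite alpha0 mul0mx mxE (bigD1 l) //= eqxx big1 ?addr0 //.
by move=> l' nl; rewrite (inj_eq (@x0col_inj p)) (negPf nl).
Qed.

Lemma chart_hilbert_series :
  has_hilbert_series V (1 + 'X *+ p.+1 + 'X^2 *+ (p.+1 - 1)).
Proof.
have natE a : (1 *+ a)%R = a :> nat by elim: a => // a IHa; rewrite mulrS IHa.
have sum0 (J : finType) (F : J -> R) : \sum_j 0 *: F j = 0.
  by rewrite big1 // => j _; rewrite scale0r.
have hE i : (1 + 'X *+ p.+1 + 'X^2 *+ (p.+1 - 1) : {poly nat})`_i =
    nth 0%N [:: 1%N; p.+1; p] i.
  rewrite !coefD coef1 !coefMn coefX coefXn subn1 /=.
  case: i => [|[|[|i]]]; rewrite /= ?mul0rn ?nth_nil ?add0r ?addr0 //;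
    exact: natE.
move=> i; rewrite hE.
case: i => [|[|[|i]]] /=.
- exists (fun=> 1); split=> [_|a|u].
  + by exists 1; rewrite ?quad_proj1 ?dhomog1.
  + rewrite big_ord1 => a0 j.
    have [|a00 _ _] := @nf_indep (a ord0) (fun=> 0) (fun=> 0).
      by rewrite !sum0 !addr0.
    by rewrite ord1.
  + apply: graded_piece_span => m /eqP; rewrite mdeg_eq0 => /eqP->.
    by exists (fun=> 1); rewrite big_ord1 scale1r mpolyX0 quad_proj1.
- exists X; split=> [j|a a0|u].
  + by exists 'X_j => //; rewrite dhomogX /= mdeg1.
  + have [|_ + _ //] := @nf_indep 0 a (fun=> 0).
    by rewrite sum0 scale0r add0r addr0.
  + apply: graded_piece_span => m /proj_deg1[j ->].
    exists (fun i => (i == j)%:R).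
    rewrite (bigD1 j) //= eqxx scale1r big1 ?addr0 //.
    by move=> l /negPf->; rewrite scale0r.
- exists Z; split=> [l|t t0|u].
  + exists ('X_[qmon (x0col l)]); first by rewrite dhomogX /= mdeg_qmon.
    by rewrite /Z XX_Y.
  + have [|_ _ + //] := @nf_indep 0 (fun=> 0) t.
    by rewrite sum0 scale0r !add0r.
  + apply: graded_piece_span => m; exact: proj_deg2.
- rewrite nth_nil; exists (fun=> 0); split=> [[]//|a _ []//|u].
  apply: graded_piece_span => m dm; exists (fun=> 0).
  by rewrite big_ord0 proj_deg3 // dm.
Qed.

Lemma chart_exact_zero_divisor : exact_zero_divisor (X ord0).
Proof.
exact: (linear_exact_zero_divisor XX_span xw0 wXE G_unit wc0_neq0 nf_span
          nf_indep).
Qed.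

Lemma chart_not_gorenstein : (1 < p)%N -> ~ gorenstein R.
Proof.
exact: (linear_not_gorenstein XX_span xw0 wXE G_unit wc0_neq0 nf_span
          nf_indep).
Qed.

End ChartPoint.

(** * The open set *)

Section ChartLocus.
Context (k : fieldType) (p : nat).
Context (r0 : 'I_(grass_dim p.+1) -> 'I_(qform_dim p.+1)).
Context (i0 : 'I_(grass_dim p.+1)).
Local Notation n := (grass_dim p.+1).

(** The points at which [chart_form] does not vanish, for some basis or,
    equivalently by [chart_locus_basis], for every basis. *)
Definition chart_locus (pi : grass k p.+1) : Prop :=
  exists2 b : n.-tuple (qform k p.+1),
    basis_of (val pi) b & chart_value r0 i0 (coef_mx b) != 0.

Lemma coef_mx_basis (V : {vspace qform k p.+1})
    (b b' : n.-tuple (qform k p.+1)) :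
  basis_of V b -> basis_of V b' -> exists A, coef_mx b' = A *m coef_mx b.
Proof.
move=> V_b V_b'; exists (\matrix_(i, j) coord b j (tnth b' i)).
apply/matrixP=> i c; rewrite !mxE.
have Vb'i : tnth b' i \in V by apply: (basis_mem V_b'); apply: mem_tnth.
rewrite [tnth b' i in LHS](coord_basis V_b Vb'i).
rewrite (raddf_sum (@mpoly_of_dhomog p.+1 k 2)) raddf_sum /=.
by apply: eq_bigr => j _; rewrite /= mcoeffZ !mxE (tnth_nth 0 b).
Qed.

Lemma chart_locus_basis (pi : grass k p.+1) (b : n.-tuple (qform k p.+1)) :
  basis_of (val pi) b -> chart_locus pi <-> chart_value r0 i0 (coef_mx b) != 0.
Proof.
move=> pi_b; split=> [[b' pi_b']|]; last by exists b.
have [A ->] := coef_mx_basis pi_b pi_b'.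
by rewrite chart_value_mul mulf_eq0 => /norP[].
Qed.

Lemma chart_locus_open : grass_open chart_locus.
Proof.
have [F homF FE] := chart_value_plucker k r0 i0.
exists (fun v => F.@[v] != 0).
  exists (eq F); split=> [_ <-|v _]; first by exists (1 + p * 2)%N.
  by split=> [Fv|[_ <-]]; first exists F.
move=> v _; split=> [[pi [b [Upi pi_b vE]]]|[[pi [b [_ pi_b vE]]] Fv]].
  split; first by exists pi, b.
  by rewrite (meval_eq _ vE) -FE; apply/(chart_locus_basis pi_b).
exists pi, b; split=> //; apply/(chart_locus_basis pi_b).
by rewrite FE -(meval_eq _ vE).
Qed.

Hypothesis r0_inj : injective r0.
Hypothesis r0_neq_x0col : forall i l, r0 i != x0col l.
Hypothesis r0i0 : r0 i0 = qcol ord0 ord0.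

Lemma qmon_homog c : ('X_[qmon c] : {mpoly k[p.+1]}) \is 2.-homog.
Proof. by rewrite dhomogX /= mdeg_qmon. Qed.

(** The span of the pivot monomials: [w] is [X_0], and [X_0 ^ 2] and the
    [X_i X_j] with [i] and [j] positive vanish in the quotient. *)
Lemma chart_locus_nonempty : exists pi, chart_locus pi.
Proof.
pose q i : qform k p.+1 := DHomog (qmon_homog (r0 i)).
have [b bq] : exists b : n.-tuple (qform k p.+1), forall i, tnth b i = q i.
  by exists [tuple q i | i < n] => i; rewrite tnth_mktuple.
have bE i c : (mpoly_of_dhomog (tnth b i))@_(qmon c) = (r0 i == c)%:R.
  by rewrite bq mcoeffX (inj_eq (@qmon_inj _)).
have free_b : free b.
  apply/freeP => a a0 i.
  have := congr1 (fun u => (mpoly_of_dhomog u)@_(qmon (r0 i))) a0.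
  rewrite (raddf_sum (@mpoly_of_dhomog p.+1 k 2)) raddf_sum /= mcoeff0.
  rewrite (bigD1 i) //= big1 => [|j nj].
    by rewrite mcoeffZ -tnth_nth bE eqxx mulr1 addr0.
  by rewrite mcoeffZ -tnth_nth bE (inj_eq r0_inj) (negPf nj) mulr0.
have dim_b : \dim <<b>> == n by move/eqP: free_b => ->; rewrite size_tuple.
exists (exist _ <<b>>%VS dim_b); exists b.
  by rewrite /= /basis_of eqxx.
have ME i c : coef_mx b i c = (r0 i == c)%:R by rewrite mxE bE.
have C1 : colsub r0 (coef_mx b) = 1%:M.
  by apply/matrixP=> i j; rewrite [LHS]mxE ME (inj_eq r0_inj) mxE.
rewrite /chart_value C1 adj1 mul1mx det1 /chart_form mul1r.
rewrite (_ : partner_mx _ _ _ _ = 1%:M) ?det1 ?oner_eq0 //.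
apply/matrixP=> l l'; rewrite !mxE big_ord_recl big1 => [|j _].
  rewrite /partner_coef ME r0i0 eqxx mul1r addr0 /red_coef.
  rewrite (inj_eq (@x0col_inj p)) big1 ?subr0 // => i _.
  by rewrite ME (negPf (r0_neq_x0col _ _)) mul0rn.
rewrite /partner_coef ME r0i0 [_ == _](_ : _ = false) ?mul0r //.
apply/negP => /eqP/esym; rewrite -r0i0 => /eqP.
by rewrite eq_sym (negPf (r0_neq_x0col _ _)).
Qed.

End ChartLocus.

Theorem mainTheorem3 (k : fieldType) (k_inf : infinite_field k)
    (e : nat) (e_ge3 : (3 <= e)%N) :
  exists U : grass k e -> Prop,
    [/\ grass_open U,
        exists pi, U pi
      & forall pi, U pi ->
          let R := quad_alg (val pi) in
          [/\ has_hilbert_series (val pi) (1 + 'X *+ e + 'X^2 *+ (e - 1)),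
              ~ gorenstein R,
              exists M : lmodType R, totally_reflexive M /\ ~ is_free M
            & exists x : R, exact_zero_divisor x]].
Proof.
case: e e_ge3 => // p p_ge2.
have [r0 [r0_inj r0_neq colP]] := chart_columns p.
have [i0 r0i0] : exists i0, r0 i0 = qcol ord0 ord0.
  have [[i ->]|[l]] := colP (qcol ord0 ord0); first by exists i.
  move/(congr1 (@qmon _)); rewrite !qmon_qcol => /mnmP/(_ (lift ord0 l)).
  by rewrite !mnmDE !mnm1E eqxx.
exists (chart_locus r0 i0); split.
- exact: chart_locus_open.
- exact: chart_locus_nonempty.
move=> pi [b pi_b b_neq0] R.
have ezd := chart_exact_zero_divisor r0_inj r0_neq colP r0i0 pi_b b_neq0.
split.
- exact: (chart_hilbert_series r0_inj r0_neq colP r0i0 pi_b b_neq0).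
- exact: (chart_not_gorenstein r0_inj r0_neq colP r0i0 pi_b b_neq0 p_ge2).
- have [x_neq0 x_nonunit [w [ann_x ann_w]]] := ezd.
  have w_neq0 : w != 0.
    apply/eqP => w0; apply: x_nonunit.
    have [z xz] : exists z, 1 = z * _ := (ann_w 1).1 (etrans (mul1r w) w0).
    by exists z.
  exists (ideal_mod (principal w)); split.
    exact: (totally_reflexive_principal ann_x ann_w).
  exact: (principal_not_free x_neq0 w_neq0 ann_x).
- by eexists; exact: ezd.
Qed.
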